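(* Let $(a_n)_{n\ge 1}$ be a sequence of real numbers such that the power series $a(z)=\sum_{n=1}^{\infty}a_nz^n$ converges at every point of the closed disc $\{z\in\mathbb{C}:|z|\le 1\}$. If the function $1-a(z)$ is continuous on $\{z\in\mathbb{C}:|z|\le 1\}$ and has no zero there, then the null solution of the Volterra difference equation $x_n=\sum_{i=0}^{n-1}a_{n-i}x_i$, $n\ge 1$, is asymptotically stable.
   Context: A solution of the equation $x_n=\sum_{i=0}^{n-1}a_{n-i}x_i$ ($n\ge1$) is the sequence $(x_n)_{n\ge 0}$ generated recursively from an initial condition $x_0\in\mathbb{R}$. The null solution is the one with $x_0=0$. The null solution is stable if for every $\varepsilon>0$ there is $\delta>0$ such that $|x_0|<\delta$ implies $|x_n|<\varepsilon$ for all $n\ge 0$. It is asymptotically stable if it is stable and there is $\delta>0$ such that $|x_0|<\delta$ implies $x_n\to 0$ as $n\to\infty$. *)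

(* Defs.v *)
From Stdlib Require Import Reals.
From Coquelicot Require Import Coquelicot.
Open Scope R_scope.

(* A sequence (a_n)_{n >= 1} is a function on nat whose value at 0 is never
   used: below, a is only evaluated at positive indices. *)

(* [sum_n f m] is f 0 + ... + f m, hence the upper bound [n - 1]. *)
Definition is_solution (a x : nat -> R) : Prop :=
  forall n : nat, (1 <= n)%nat ->
    x n = sum_n (fun i => a (n - i)%nat * x i) (n - 1)%nat.

(* The null solution is the one with x_0 = 0. *)
Definition null_stable (a : nat -> R) : Prop :=
  forall eps : R, 0 < eps -> exists delta : R, 0 < delta /\
    forall x : nat -> R, is_solution a x -> Rabs (x 0%nat) < delta ->
      forall n : nat, Rabs (x n) < eps.

Definition null_attractive (a : nat -> R) : Prop :=
  exists delta : R, 0 < delta /\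
    forall x : nat -> R, is_solution a x -> Rabs (x 0%nat) < delta ->
      is_lim_seq x 0.

Definition null_asymptotically_stable (a : nat -> R) : Prop :=
  null_stable a /\ null_attractive a.

Definition closed_disc (z : C) : Prop := Cmod z <= 1.

(* The series starts at n = 1, whence the shift n = k + 1. *)
Definition power_series_sum (a : nat -> R) (z s : C) : Prop :=
  is_series (fun k : nat => (RtoC (a (S k)) * Cpow z (S k))%C) s.

(* Main.v *)
Require Import Defs.
From Stdlib Require Import Reals Lra Lia Wf_nat ClassicalEpsilon.
From Coquelicot Require Import Coquelicot.
Open Scope R_scope.

(** A solution is [x 0] times the coefficient sequence of [1 / (1 - a(z))], so
    everything follows from the square-summability of these coefficients, with
    the bound [1 / inf |1 - a|^2] that Parseval's identity suggests. Boundedness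
    of [x n / x 0] is stability, and terms of a convergent series tend to [0].
    Parseval cannot be applied directly, since the Taylor coefficients of the
    reciprocal are not known beforehand to be the Fourier coefficients of its
    boundary values; this is where the absence of zeros inside the disc must
    enter. The usual tool is Cauchy's formula. It is replaced here by a
    continuity method on square sums which uses finite sums only.

    By compactness [|1 - a(z)| >= c > 0] on the closed disc. For [rho < 1] the
    series of [a(rho z)] converges uniformly there, so a truncation gives a
    polynomial [p] with [p 0 = 1] and [|p(z)| >= c / 2] on the closed disc, and
    [x k * rho ^ k] agrees, up to the degree of [p], with the solution [w] of
    [p * w = x 0], where [*] is the Cauchy product ([solution_conv]). It
    remains to bound the square sum of [w] independently of [p].

    - If [|p| >= c] on the unit circle and [w] is finite, then
      [c^2 |w|^2 <= |p * w|^2] for the square sums: this is Parseval over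
      sufficiently many roots of unity ([conv_lower_bound_finite]). By truncation
      the bound persists when [w] only tends to [0] and [p * w] is finite
      ([conv_lower_bound]).
    - Call [p] decaying if [w] tends to [0] whenever [p * w] is finite. If [p] is
      decaying and [p'] is close to it, then [p'] is decaying, because the bound
      above, applied to [p], absorbs the error term [(p' - p) * w]
      ([decaying_perturb]).
    - The dilated polynomials [p(s z)] go from the constant [1], which is
      decaying, to [p]. They satisfy the same lower bound on the unit circle
      because [p] does on the whole disc, so steps of a fixed size suffice
      ([zero_free_decaying]).

    Finally [rho] tends to [1] in the resulting inequality
    ([sqsum_Abel_limit]). *)

(** * Finite sums *)

Lemma sum_n_R_S (f : nat -> R) n : sum_n f (S n) = sum_n f n + f (S n) :> R.
Proof. exact (sum_Sn f n). Qed.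

Lemma sum_n_C_S (f : nat -> C) n : sum_n f (S n) = (sum_n f n + f (S n))%C :> C.
Proof. exact (sum_Sn f n). Qed.

Lemma sum_n_R_head (f : nat -> R) n :
  sum_n f (S n) = f 0%nat + sum_n (fun k => f (S k)) n :> R.
Proof.
  induction n as [|n IH]; [now rewrite sum_n_R_S, !sum_O|].
  rewrite sum_n_R_S, IH, sum_n_R_S; ring.
Qed.

Lemma sum_n_C_head (f : nat -> C) n :
  sum_n f (S n) = (f 0%nat + sum_n (fun k => f (S k)) n)%C :> C.
Proof.
  induction n as [|n IH]; [now rewrite sum_n_C_S, !sum_O|].
  rewrite sum_n_C_S, IH, sum_n_C_S; ring.
Qed.

Lemma sum_n_R_ext (f g : nat -> R) n :
  (forall k, f k = g k) -> sum_n f n = sum_n g n :> R.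
Proof. exact (sum_n_ext f g n). Qed.

Lemma sum_n_C_ext (f g : nat -> C) n :
  (forall k, f k = g k) -> sum_n f n = sum_n g n :> C.
Proof. exact (sum_n_ext f g n). Qed.

Lemma sum_n_R_le (f g : nat -> R) n :
  (forall k, (k <= n)%nat -> f k <= g k) -> sum_n f n <= sum_n g n.
Proof.
  induction n as [|n IH]; intros H; [rewrite !sum_O; auto|].
  rewrite !sum_n_R_S. apply Rplus_le_compat; auto.
Qed.

Lemma sum_n_R_scal (c : R) (f : nat -> R) n :
  sum_n (fun k => c * f k) n = c * sum_n f n :> R.
Proof. exact (sum_n_mult_l c f n). Qed.

Lemma sum_n_R_plus (f g : nat -> R) n :
  sum_n (fun k => f k + g k) n = sum_n f n + sum_n g n :> R.
Proof. exact (sum_n_plus f g n). Qed.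

Lemma sum_n_C_scal (c : C) (f : nat -> C) n :
  sum_n (fun k => (c * f k)%C) n = (c * sum_n f n)%C :> C.
Proof. exact (sum_n_mult_l c f n). Qed.

Lemma sum_n_C_plus (f g : nat -> C) n :
  sum_n (fun k => (f k + g k)%C) n = (sum_n f n + sum_n g n)%C :> C.
Proof. exact (sum_n_plus f g n). Qed.

Lemma sum_n_R_rev (f : nat -> R) n : sum_n (fun k => f (n - k)%nat) n = sum_n f n :> R.
Proof.
  induction n as [|n IH]; [now rewrite !sum_O|].
  rewrite sum_n_R_head, sum_n_R_S. simpl. rewrite IH. ring.
Qed.

Lemma sum_n_R_ge_term (f : nat -> R) n k :
  (forall j, 0 <= f j) -> (k <= n)%nat -> f k <= sum_n f n.
Proof.
  intros Hf; induction n as [|n IH]; intros Hk.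
  - replace k with 0%nat by lia. rewrite sum_O; lra.
  - rewrite sum_n_R_S. destruct (Nat.eq_dec k (S n)) as [->|].
    + assert (0 <= sum_n f n).
      { rewrite <- (Rmult_0_l (sum_n f n)), <- sum_n_R_scal.
        apply sum_n_R_le. intros j _; specialize (Hf j); lra. }
      lra.
    + assert (k <= n)%nat by lia. specialize (IH H). specialize (Hf (S n)). lra.
Qed.

Lemma sum_n_R_zero_tail (f : nat -> R) m M :
  (forall k, (m < k)%nat -> f k = 0) -> (m <= M)%nat -> sum_n f M = sum_n f m :> R.
Proof.
  intros H; induction 1 as [|M L IH]; [reflexivity|].
  rewrite sum_n_R_S, IH, H by lia. ring.
Qed.

Lemma Rabs_sum_n (f : nat -> R) n :
  Rabs (sum_n f n) <= sum_n (fun k => Rabs (f k)) n.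
Proof.
  induction n as [|n IH]; [rewrite !sum_O; apply Rle_refl|].
  rewrite !sum_n_R_S. eapply Rle_trans; [apply Rabs_triang|]. lra.
Qed.

(** * Square sums and finitely supported sequences *)

Definition sqsum (w : nat -> R) (n : nat) : R := sum_n (fun k => w k ^ 2) n.

Definition supported (m : nat) (w : nat -> R) : Prop :=
  forall k, (m < k)%nat -> w k = 0.

Definition trunc (m : nat) (w : nat -> R) (k : nat) : R :=
  if (k <=? m)%nat then w k else 0.

Lemma trunc_below m w k : (k <= m)%nat -> trunc m w k = w k.
Proof. intros H; unfold trunc. now rewrite (proj2 (Nat.leb_le k m) H). Qed.

Lemma trunc_supported m w : supported m (trunc m w).
Proof. intros k H; unfold trunc. now rewrite (proj2 (Nat.leb_gt k m) H). Qed.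

Lemma sqsum_S w n : sqsum w (S n) = sqsum w n + w (S n) ^ 2.
Proof. exact (sum_n_R_S _ _). Qed.

Lemma sqsum_ext w w' n :
  (forall k, (k <= n)%nat -> w k = w' k) -> sqsum w n = sqsum w' n.
Proof. intros H; apply sum_n_ext_loc; intros k Hk; now rewrite H. Qed.

Lemma sqsum_ge_term w n k : (k <= n)%nat -> w k ^ 2 <= sqsum w n.
Proof.
  apply (sum_n_R_ge_term (fun k => w k ^ 2)). intros; apply pow2_ge_0.
Qed.

Lemma sqsum_mono w n m : (n <= m)%nat -> sqsum w n <= sqsum w m.
Proof.
  induction 1 as [|m _ IH]; [lra|].
  rewrite sqsum_S. generalize (pow2_ge_0 (w (S m))); lra.
Qed.

Lemma sqsum_tail w m e b :
  (forall k, (m < k)%nat -> w k ^ 2 <= b) -> sqsum w (m + e) <= sqsum w m + INR e * b.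
Proof.
  intros H; induction e as [|e IH]; [rewrite Nat.add_0_r; simpl; lra|].
  rewrite Nat.add_succ_r, sqsum_S, S_INR.
  specialize (H (S (m + e)) ltac:(lia)). lra.
Qed.

Lemma sqsum_supported m w n : supported m w -> sqsum w n <= sqsum w m.
Proof.
  intros H. destruct (Nat.le_ge_cases n m) as [L|L]; [now apply sqsum_mono|].
  replace n with (m + (n - m))%nat by lia.
  replace (sqsum w m) with (sqsum w m + INR (n - m) * 0) by ring.
  apply sqsum_tail. intros k Hk. rewrite H by easy. lra.
Qed.

(** * Products of a polynomial and a sequence *)

Definition shift (j : nat) (w : nat -> R) (k : nat) : R :=
  if (j <=? k)%nat then w (k - j)%nat else 0.

(** The upper summation bound is the degree of the polynomial, not the index as
    in the usual form of the Cauchy product: multiplication is then a fixed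
    combination of shifts. *)
Definition conv (d : nat) (p w : nat -> R) (k : nat) : R :=
  sum_n (fun j => p j * shift j w k) d.

Definition peval (p : nat -> R) (d : nat) (z : C) : C :=
  sum_n (fun k => (RtoC (p k) * z ^ k)%C) d.

Lemma shift_0 w k : shift 0 w k = w k.
Proof. unfold shift; simpl. now rewrite Nat.sub_0_r. Qed.

Lemma conv_S d p w k : conv (S d) p w k = conv d p w k + p (S d) * shift (S d) w k.
Proof. exact (sum_n_R_S _ _). Qed.

Lemma conv_minus d p v w k :
  conv d p (fun i => v i - w i) k = conv d p v k - conv d p w k.
Proof.
  induction d as [|d IH].
  - unfold conv; rewrite !sum_O, !shift_0. ring.
  - rewrite !conv_S, IH. unfold shift. destruct (S d <=? k)%nat; ring.
Qed.

Lemma conv_plus_l d p q w k :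
  conv d (fun j => p j + q j) w k = conv d p w k + conv d q w k.
Proof.
  unfold conv. rewrite <- sum_n_R_plus. apply sum_n_R_ext; intros j; ring.
Qed.

(** Multiplication by [p] is triangular with diagonal [p 0]. Causality,
    uniqueness and existence of quotients below are consequences, applied to a
    difference of two sequences. *)
Lemma conv_leading d p w k :
  (forall i, (i < k)%nat -> w i = 0) -> conv d p w k = p 0%nat * w k.
Proof.
  intros H; induction d as [|d IH].
  - unfold conv; now rewrite sum_O, shift_0.
  - rewrite conv_S, IH. unfold shift.
    destruct (S d <=? k)%nat eqn:E; [|ring].
    apply Nat.leb_le in E. rewrite (H (k - S d)%nat) by lia. ring.
Qed.

Lemma conv_causal d p v w k :
  (forall i, (i <= k)%nat -> v i = w i) -> conv d p v k = conv d p w k.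
Proof.
  intros H. cut (conv d p (fun i => v i - w i) k = 0).
  { rewrite conv_minus; intros E; lra. }
  rewrite conv_leading.
  - rewrite H by lia. ring.
  - intros i Hi. rewrite H by lia. ring.
Qed.

Lemma conv_unique d p v w n :
  p 0%nat = 1 ->
  (forall k, (k <= n)%nat -> conv d p v k = conv d p w k) ->
  forall k, (k <= n)%nat -> v k = w k.
Proof.
  intros p0 H k. induction k as [k IH] using (well_founded_ind lt_wf). intros Hk.
  assert (E : conv d p (fun i => v i - w i) k = p 0%nat * (v k - w k)).
  { apply conv_leading. intros i Hi. rewrite IH by lia. ring. }
  rewrite conv_minus, H, p0 in E by easy. lra.
Qed.

(** The value at [k] of the quotient is determined by the values below [k];
    the iterates of the recursion, started at [0], are therefore constant at
    index [k] from step [k + 1] on. *)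
Lemma conv_solution_exists d p g :
  p 0%nat = 1 -> exists w, forall k, conv d p w k = g k.
Proof.
  intros p0.
  set (F := fun (w : nat -> R) k => g k - (conv d p w k - w k)).
  assert (HF : forall v w k, (forall i, (i < k)%nat -> v i = w i) -> F v k = F w k).
  { intros v w k H. unfold F.
    assert (E : conv d p (fun i => v i - w i) k = p 0%nat * (v k - w k)).
    { apply conv_leading. intros i Hi. rewrite H by easy. ring. }
    rewrite conv_minus, p0 in E. lra. }
  set (W := fun n => Nat.iter n F (fun _ => 0)).
  assert (St : forall k n, (k < n)%nat -> W n k = W (S k) k).
  { intros k; induction k as [k IH] using (well_founded_ind lt_wf).
    intros [|n] Hn; [lia|]. apply HF. intros i Hi.
    change (W n i = W k i). rewrite (IH i Hi n), (IH i Hi k) by lia. reflexivity. }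
  exists (fun k => W (S k) k). intros k.
  assert (E : F (fun k => W (S k) k) k = W (S k) k).
  { apply (HF _ (W k)). intros i Hi. symmetry. now apply St. }
  unfold F in E. lra.
Qed.

Lemma sqsum_shift j w n : sqsum (shift j w) n <= sqsum w n.
Proof.
  revert n; induction j as [|j IH]; intros n.
  - right; apply sqsum_ext; intros; apply shift_0.
  - destruct n as [|n].
    + unfold sqsum; rewrite !sum_O. change (0 ^ 2 <= w 0%nat ^ 2).
      generalize (pow2_ge_0 (w 0%nat)); lra.
    + replace (sqsum (shift (S j) w) (S n)) with (sqsum (shift j w) n).
      * eapply Rle_trans; [apply IH|apply sqsum_mono; lia].
      * unfold sqsum. rewrite (sum_n_R_head (fun k => shift (S j) w k ^ 2)).
        unfold shift at 2; simpl (S j <=? 0)%nat; cbv iota.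
        rewrite pow_i, Rplus_0_l by lia. reflexivity.
Qed.

(** The constant [4 ^ d] is crude but harmless: what matters is that it depends
    neither on [n] nor on [w], so that a small enough [p] acts as an arbitrarily
    small operator on square sums. *)
Lemma sqsum_conv_le d p eta w n :
  0 <= eta -> (forall j, (j <= d)%nat -> Rabs (p j) <= eta) ->
  sqsum (conv d p w) n <= 4 ^ d * eta ^ 2 * sqsum w n.
Proof.
  intros He Hp.
  assert (Hs : forall j, (j <= d)%nat ->
    sqsum (fun k => p j * shift j w k) n <= eta ^ 2 * sqsum w n).
  { intros j Hj. unfold sqsum at 1.
    rewrite (sum_n_R_ext _ (fun k => p j ^ 2 * shift j w k ^ 2)) by (intros; ring).
    rewrite sum_n_R_scal. apply Rmult_le_compat.
    - apply pow2_ge_0.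
    - apply Rle_trans with (shift j w 0 ^ 2); [apply pow2_ge_0|].
      apply (sqsum_ge_term (shift j w)); lia.
    - rewrite <- (pow2_abs (p j)). apply pow_incr. split; [apply Rabs_pos|auto].
    - apply sqsum_shift. }
  assert (He2 : 0 <= eta ^ 2 * sqsum w n).
  { apply Rmult_le_pos; [apply pow2_ge_0|].
    apply Rle_trans with (w 0%nat ^ 2); [apply pow2_ge_0|apply sqsum_ge_term; lia]. }
  clear Hp He. induction d as [|d IH].
  - specialize (Hs 0%nat ltac:(lia)).
    rewrite (sqsum_ext _ (fun k => p 0%nat * shift 0 w k)).
    + simpl in *; lra.
    + intros k _; unfold conv; now rewrite sum_O.
  - specialize (IH ltac:(intros; apply Hs; lia)). specialize (Hs (S d) ltac:(lia)).
    apply Rle_trans with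
      (2 * sqsum (conv d p w) n + 2 * sqsum (fun k => p (S d) * shift (S d) w k) n).
    + unfold sqsum. rewrite <- !sum_n_R_scal, <- sum_n_R_plus.
      apply sum_n_R_le. intros k _. rewrite conv_S.
      generalize (pow2_ge_0 (conv d p w k - p (S d) * shift (S d) w k)). simpl; lra.
    + assert (1 <= 4 ^ d) by (apply pow_R1_Rle; lra).
      assert (eta ^ 2 * sqsum w n <= 4 ^ d * (eta ^ 2 * sqsum w n)) by nra.
      simpl (4 ^ S d). lra.
Qed.

Lemma peval_ext p q d z :
  (forall k, (k <= d)%nat -> p k = q k) -> peval p d z = peval q d z.
Proof. intros H; apply sum_n_ext_loc; intros k Hk; now rewrite H. Qed.

(** Shifting by [j] while extending the range by [j] loses no term. *)
Lemma peval_shift j w m z : peval (shift j w) (j + m) z = (z ^ j * peval w m z)%C.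
Proof.
  induction j as [|j IH].
  - simpl. rewrite Cmult_1_l. apply peval_ext; intros; apply shift_0.
  - unfold peval at 1. rewrite Nat.add_succ_l, sum_n_C_head.
    unfold shift at 1; simpl (S j <=? 0)%nat; cbv iota.
    rewrite Cmult_0_l, Cplus_0_l, Cpow_S, <- Cmult_assoc, <- IH.
    unfold peval. rewrite <- sum_n_C_scal. apply sum_n_C_ext; intros k.
    change (shift (S j) w (S k)) with (shift j w k). rewrite Cpow_S. ring.
Qed.

Lemma peval_supported m M w z :
  supported m w -> (m <= M)%nat -> peval w M z = peval w m z.
Proof.
  intros H; induction 1 as [|M L IH]; [reflexivity|].
  unfold peval in *. rewrite sum_n_C_S, IH, H by lia. ring.
Qed.

Lemma supported_shift j m w : supported m w -> supported (j + m) (shift j w).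
Proof.
  intros H k Hk. unfold shift. destruct (j <=? k)%nat; [apply H; lia|reflexivity].
Qed.

Lemma supported_conv d p m w : supported m w -> supported (d + m) (conv d p w).
Proof.
  intros H; induction d as [|d IH]; intros k Hk.
  - unfold conv. rewrite sum_O, shift_0, H by lia. ring.
  - rewrite conv_S, IH by lia.
    rewrite (supported_shift (S d) m w H) by lia. ring.
Qed.

Lemma peval_conv d p m w z :
  supported m w -> peval (conv d p w) (d + m) z = (peval p d z * peval w m z)%C.
Proof.
  intros H. induction d as [|d IH].
  - unfold peval at 2. rewrite sum_O. simpl.
    rewrite Cmult_1_r. unfold peval. rewrite <- sum_n_C_scal.
    apply sum_n_C_ext; intros k. unfold conv. rewrite sum_O, shift_0, RtoC_mult. ring.
  - unfold peval at 2. rewrite sum_n_C_S. fold (peval p d z).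
    rewrite Cmult_plus_distr_r, <- IH, <- Cmult_assoc, <- peval_shift.
    rewrite <- (peval_supported (d + m) (S d + m)) by (auto using supported_conv; lia).
    unfold peval. rewrite <- sum_n_C_scal, <- sum_n_C_plus.
    apply sum_n_C_ext; intros k. rewrite conv_S, RtoC_plus, RtoC_mult. ring.
Qed.

(** * Parseval's identity over dyadic roots of unity *)

(** The average of [F] over the angles [2 pi j / 2 ^ q]. Halving an angle
    in the two possible ways passes from the roots of unity of order [2 ^ q] to
    those of order [2 ^ (q + 1)], so that the splitting of a polynomial into its
    even and odd parts matches the recursion. *)
Fixpoint circle_mean (q : nat) (F : R -> R) : R :=
  match q with
  | O => F 0
  | S q => circle_mean q (fun t => (F (t / 2) + F (t / 2 + PI)) / 2)
  end.

Definition expi (t : R) : C := (cos t, sin t).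

Lemma circle_mean_le q F G : (forall t, F t <= G t) -> circle_mean q F <= circle_mean q G.
Proof.
  revert F G; induction q as [|q IH]; intros F G H; simpl; [auto|].
  apply IH. intros t. generalize (H (t / 2)) (H (t / 2 + PI)); lra.
Qed.

Lemma circle_mean_ext q F G : (forall t, F t = G t) -> circle_mean q F = circle_mean q G.
Proof. intros H; apply Rle_antisym; apply circle_mean_le; intros; rewrite H; lra. Qed.

Lemma circle_mean_plus q F G :
  circle_mean q (fun t => F t + G t) = circle_mean q F + circle_mean q G.
Proof.
  revert F G; induction q as [|q IH]; intros F G; simpl; [auto|].
  rewrite <- IH. apply circle_mean_ext. intros; field.
Qed.

Lemma circle_mean_scal q c F :
  circle_mean q (fun t => c * F t) = c * circle_mean q F.
Proof.
  revert F; induction q as [|q IH]; intros F; simpl; [auto|].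
  rewrite <- IH. apply circle_mean_ext. intros; field.
Qed.

Lemma Cmod_expi t : Cmod (expi t) = 1.
Proof.
  unfold Cmod, expi; simpl fst; simpl snd.
  replace (cos t ^ 2 + sin t ^ 2) with 1; [apply sqrt_1|].
  rewrite <- (sin2_cos2 t). unfold Rsqr. ring.
Qed.

Lemma expi_half t : (expi (t / 2) * expi (t / 2))%C = expi t.
Proof.
  transitivity (expi (2 * (t / 2))); [|f_equal; field].
  unfold expi, Cmult; simpl. rewrite cos_2a, sin_2a. f_equal; ring.
Qed.

Lemma expi_antipode t : expi (t + PI) = (- expi t)%C.
Proof. unfold expi, Copp; simpl. now rewrite neg_cos, neg_sin. Qed.

Lemma Cmod_parallelogram u v :
  Cmod (u + v)%C ^ 2 + Cmod (u - v)%C ^ 2 = 2 * (Cmod u ^ 2 + Cmod v ^ 2).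
Proof. rewrite !Cmod2_alt. destruct u, v; simpl. ring. Qed.

Lemma peval_even_odd f n z :
  peval f (2 * n + 1) z =
  (peval (fun k => f (2 * k)%nat) n (z * z)
   + z * peval (fun k => f (2 * k + 1)%nat) n (z * z))%C.
Proof.
  unfold peval. rewrite <- sum_n_C_scal, <- sum_n_C_plus.
  assert (Hz : forall k, ((z * z) ^ k)%C = (z ^ (2 * k))%C).
  { intros k. rewrite Cpow_mult_r. f_equal. simpl; ring. }
  induction n as [|n IH].
  - change (2 * 0 + 1)%nat with 1%nat. rewrite sum_n_C_S, !sum_O. simpl. ring.
  - replace (2 * S n + 1)%nat with (S (S (2 * n + 1))) by lia.
    rewrite !sum_n_C_S, IH, Hz.
    replace (2 * S n)%nat with (S (2 * n + 1)) by lia.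
    replace (S (2 * n + 1) + 1)%nat with (S (S (2 * n + 1))) by lia.
    rewrite (Cpow_S z (S (2 * n + 1))). ring.
Qed.

Lemma sqsum_even_odd f n :
  sqsum f (2 * n + 1) =
  sqsum (fun k => f (2 * k)%nat) n + sqsum (fun k => f (2 * k + 1)%nat) n.
Proof.
  induction n as [|n IH].
  - unfold sqsum. change (2 * 0 + 1)%nat with 1%nat.
    rewrite sum_n_R_S, !sum_O. reflexivity.
  - replace (2 * S n + 1)%nat with (S (S (2 * n + 1))) by lia.
    rewrite !sqsum_S, IH.
    replace (2 * S n)%nat with (S (2 * n + 1)) by lia.
    replace (S (2 * n + 1) + 1)%nat with (S (S (2 * n + 1))) by lia. ring.
Qed.

(** With [z = exp (i t / 2)] and its antipode [-z], the values of the polynomial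
    are [E + z O] and [E - z O], where [E] and [O] are the values of the even and
    odd parts at [z^2 = exp (i t)]. The parallelogram law reduces the mean of the
    squares to the mean for these two parts, of half the length. *)
Lemma parseval q f :
  circle_mean q (fun t => Cmod (peval f (2 ^ q - 1) (expi t)) ^ 2) = sqsum f (2 ^ q - 1).
Proof.
  revert f; induction q as [|q IH]; intros f.
  - cbn [circle_mean]. change (2 ^ 0 - 1)%nat with 0%nat.
    unfold sqsum, peval. rewrite !sum_O.
    change (expi 0 ^ 0)%C with (RtoC 1). rewrite Cmult_1_r, Cmod_R. apply pow2_abs.
  - cbn [circle_mean]. set (n := (2 ^ q - 1)%nat) in *.
    replace (2 ^ S q - 1)%nat with (2 * n + 1)%nat.
    2:{ unfold n. simpl. generalize (Nat.pow_nonzero 2 q); lia. }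
    rewrite sqsum_even_odd, <- !IH, <- circle_mean_plus.
    apply circle_mean_ext; intros t.
    rewrite !peval_even_odd, expi_antipode.
    replace (- expi (t / 2) * - expi (t / 2))%C with (expi t)
      by (rewrite <- (expi_half t); ring).
    rewrite expi_half.
    set (E := peval _ n (expi t)). set (O := peval _ n (expi t)).
    replace (E + - expi (t / 2) * O)%C with (E - expi (t / 2) * O)%C by ring.
    rewrite Cmod_parallelogram, Cmod_mult, Cmod_expi. field.
Qed.

(** * Lower bounds for multiplication by a polynomial *)

(** Apply Parseval to both sides of [|p|^2 |w|^2 = |p * w|^2] on roots of unity
    of an order exceeding the length of [p * w]. *)
Lemma conv_lower_bound_finite d p c m w :
  0 <= c -> (forall z, Cmod z = 1 -> c <= Cmod (peval p d z)) -> supported m w ->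
  c ^ 2 * sqsum w m <= sqsum (conv d p w) (d + m).
Proof.
  intros Hc HP Hw.
  assert (exists q, (d + m <= 2 ^ q - 1)%nat) as [q Hq].
  { exists (d + m)%nat. generalize (Nat.pow_gt_lin_r 2 (d + m)); lia. }
  pose proof (supported_conv d p m w Hw) as Hcw.
  apply Rle_trans with (sqsum (conv d p w) (2 ^ q - 1)); [|now apply sqsum_supported].
  apply Rle_trans with (c ^ 2 * sqsum w (2 ^ q - 1)).
  { apply Rmult_le_compat_l; [apply pow2_ge_0|]. apply sqsum_mono; lia. }
  rewrite <- !parseval, <- circle_mean_scal. apply circle_mean_le. intros t.
  rewrite (peval_supported (d + m) _ _ _ Hcw Hq), peval_conv by easy.
  rewrite (peval_supported m _ _ _ Hw) by lia.
  rewrite Cmod_mult, Rpow_mult_distr.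
  apply Rmult_le_compat_r; [apply pow2_ge_0|].
  apply pow_incr. split; [easy|]. apply HP, Cmod_expi.
Qed.
(** Truncate [w] at a large [M]: the product changes only at the [d] indices
    after [M], where it is a combination of values of [w] near [M], hence small.
    Some decay of [w] is indispensable: for [p = 1 - 2 z] and [w k = 2 ^ k], the
    product is finite and [|p| >= 1] on the circle. *)
Lemma conv_lower_bound d p c m w g :
  0 <= c -> (forall z, Cmod z = 1 -> c <= Cmod (peval p d z)) ->
  is_lim_seq w 0 -> (forall k, conv d p w k = g k) -> supported m g ->
  forall n, c ^ 2 * sqsum w n <= sqsum g m.
Proof.
  intros Hc HP Hw Hg Hm n. apply le_epsilon; intros eps Heps.
  set (B := sum_n (fun j => Rabs (p j)) d : R).
  assert (HB : 0 <= B).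
  { apply Rle_trans with (Rabs (p 0%nat)); [apply Rabs_pos|].
    apply (sum_n_R_ge_term (fun j => Rabs (p j))); [intros; apply Rabs_pos|lia]. }
  (* the [d] spurious coefficients of the truncated product, each at most
     [B * delta], must contribute at most [eps] *)
  set (K := INR d * B ^ 2 + 1).
  assert (HK : 1 <= K).
  { unfold K. generalize (Rmult_le_pos _ _ (pos_INR d) (pow2_ge_0 B)). lra. }
  set (delta := sqrt (eps / K)).
  assert (Hd2 : delta ^ 2 = eps / K).
  { apply pow2_sqrt. apply Rlt_le, Rdiv_lt_0_compat; lra. }
  assert (Hd : 0 < delta) by (apply sqrt_lt_R0, Rdiv_lt_0_compat; lra).
  apply is_lim_seq_spec in Hw. destruct (Hw (mkposreal delta Hd)) as [N HN].
  set (M := (n + m + N + d)%nat). set (v := trunc M w).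
  assert (Hv : supported M v) by apply trunc_supported.
  pose proof (conv_lower_bound_finite d p c M v Hc HP Hv) as L.
  assert (L1 : sqsum w n <= sqsum v M).
  { rewrite (sqsum_ext v w); [apply sqsum_mono; unfold M; lia|].
    intros k Hk; now apply trunc_below. }
  assert (L2 : sqsum (conv d p v) M <= sqsum g m).
  { rewrite (sqsum_ext _ g); [now apply sqsum_supported|].
    intros k Hk. rewrite <- Hg. apply conv_causal.
    intros i Hi. apply trunc_below. lia. }
  assert (L3 : sqsum (conv d p v) (M + d) <= sqsum (conv d p v) M + INR d * (B * delta) ^ 2).
  { apply sqsum_tail. intros k Hk. rewrite <- (pow2_abs (conv d p v k)).
    apply pow_incr. split; [apply Rabs_pos|].
    unfold conv. eapply Rle_trans; [apply Rabs_sum_n|].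
    apply Rle_trans with (sum_n (fun j => delta * Rabs (p j)) d).
    - apply sum_n_R_le. intros j Hj. rewrite Rabs_mult, Rmult_comm. apply Rmult_le_compat_r; [apply Rabs_pos|].
      unfold shift, v, trunc.
      destruct (j <=? k)%nat, (k - j <=? M)%nat; rewrite ?Rabs_R0; try lra.
      specialize (HN (k - j)%nat ltac:(unfold M in *; lia)).
      rewrite Rminus_0_r in HN. simpl in HN. lra.
    - rewrite sum_n_R_scal. fold B. lra. }
  rewrite (Nat.add_comm d M) in L.
  assert (L4 : INR d * (B * delta) ^ 2 <= eps).
  { replace (INR d * (B * delta) ^ 2) with ((K - 1) * (eps / K)).
    - assert (0 < eps / K) by (apply Rdiv_lt_0_compat; lra).
      assert (K * (eps / K) = eps) by (field; lra). lra.
    - rewrite <- Hd2. unfold K. ring. }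
  pose proof (Rmult_le_compat_l _ _ _ (pow2_ge_0 c) L1). lra.
Qed.

Lemma bounded_sqsum_lim_0 w K : (forall n, sqsum w n <= K) -> is_lim_seq w 0.
Proof.
  intros H.
  assert (S : ex_series (fun k => w k ^ 2)).
  { apply ex_finite_lim_seq_incr with (M := K).
    - intros n. apply (sqsum_mono w n (S n)). lia.
    - exact H. }
  apply ex_series_lim_0 in S. apply is_lim_seq_spec in S. apply is_lim_seq_spec.
  intros eps. assert (He : 0 < eps ^ 2) by (apply pow_lt, cond_pos).
  destruct (S (mkposreal _ He)) as [N HN]. exists N. intros n Hn.
  specialize (HN n Hn). cbn [pos] in HN. rewrite Rminus_0_r in *.
  rewrite (Rabs_pos_eq _ (pow2_ge_0 _)), <- pow2_abs in HN.
  destruct (Rlt_le_dec (Rabs (w n)) eps) as [|C]; [easy|].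
  pose proof (pow_incr eps (Rabs (w n)) 2 (conj (Rlt_le _ _ (cond_pos eps)) C)). lra.
Qed.

(** * Zero-free polynomials have decaying reciprocals *)

Definition dilate (s : R) (p : nat -> R) (k : nat) : R := p k * s ^ k.

Lemma peval_dilate s p d z : peval (dilate s p) d z = peval p d (RtoC s * z)%C.
Proof.
  apply sum_n_C_ext; intros k. unfold dilate.
  rewrite RtoC_mult, RtoC_pow, Cpow_mult_l. ring.
Qed.

Lemma dilate_1 p k : dilate 1 p k = p k.
Proof. unfold dilate. rewrite pow1. ring. Qed.

(** A form of invertibility of [p]: the quotients of finite sequences by [p] tend
    to [0]. If [p 0 = 1], it amounts to the absence of zeros in the closed disc;
    the absence of zeros on the circle is not enough. *)
Definition decaying (d : nat) (p : nat -> R) : Prop :=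
  forall m g w, supported m g -> (forall k, conv d p w k = g k) -> is_lim_seq w 0.

Lemma Rabs_pow_minus_le x y k :
  0 <= x <= 1 -> 0 <= y <= 1 -> Rabs (x ^ k - y ^ k) <= INR k * Rabs (x - y).
Proof.
  intros Hx Hy; induction k as [|k IH].
  - simpl. rewrite Rminus_diag, Rabs_R0. lra.
  - replace (x ^ S k - y ^ S k) with (x * (x ^ k - y ^ k) + (x - y) * y ^ k) by (simpl; ring).
    rewrite S_INR. eapply Rle_trans; [apply Rabs_triang|].
    rewrite !Rabs_mult, (Rabs_pos_eq x) by lra.
    assert (0 <= y ^ k <= 1).
    { split; [apply pow_le; lra|]. rewrite <- (pow1 k). apply pow_incr; lra. }
    rewrite (Rabs_pos_eq (y ^ k)) by lra.
    generalize (Rabs_pos (x ^ k - y ^ k)) (Rabs_pos (x - y)). nra.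
Qed.

(** Write [p * w' = g - (p' - p) * w'] and cut the right-hand side at index [n].
    The quotient of this finite sequence by [p] tends to [0], so
    [conv_lower_bound] applies to it, and it agrees with [w'] up to [n]. This
    yields [c^2 |w'|^2 <= 2 |g|^2 + 2 (c^2 / 4) |w'|^2] for square sums up to [n],
    and the last term is absorbed on the left. The finite sums make this
    legitimate although the square-summability of [w'] is not yet known. *)
Lemma decaying_perturb d p p' c eta :
  0 < c -> (forall z, Cmod z = 1 -> c <= Cmod (peval p d z)) ->
  p 0%nat = 1 -> 0 <= eta -> 4 ^ d * eta ^ 2 <= c ^ 2 / 4 ->
  (forall j, (j <= d)%nat -> Rabs (p' j - p j) <= eta) ->
  decaying d p -> decaying d p'.
Proof.
  intros Hc HP p0 He Hsmall Hp' D m g w' Hg Hw'.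
  apply bounded_sqsum_lim_0 with (4 / c ^ 2 * sqsum g m). intros n.
  set (h := trunc n (conv d p w')).
  destruct (conv_solution_exists d p h p0) as [w Hw].
  assert (Hh : supported n h) by apply trunc_supported.
  assert (Ew : forall k, (k <= n)%nat -> w k = w' k).
  { apply (conv_unique d p); [easy|]. intros k Hk. rewrite Hw. now apply trunc_below. }
  pose proof (conv_lower_bound d p c n w h (Rlt_le _ _ Hc) HP (D n h w Hh Hw) Hw Hh n) as L.
  rewrite (sqsum_ext w w' n Ew) in L.
  set (q := fun j => p' j - p j).
  pose proof (sqsum_conv_le d q eta w' n He Hp') as Lq.
  assert (Lh : sqsum h n <= 2 * sqsum g n + 2 * sqsum (conv d q w') n).
  { unfold sqsum. rewrite <- !sum_n_R_scal, <- sum_n_R_plus. apply sum_n_R_le.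
    intros k Hk. unfold h. rewrite trunc_below by easy. rewrite <- Hw'.
    assert (E : conv d p' w' k = conv d p w' k + conv d q w' k).
    { rewrite <- conv_plus_l. apply sum_n_R_ext. intros j. unfold q. ring. }
    rewrite E. generalize (pow2_ge_0 (conv d p w' k + 2 * conv d q w' k)). nra. }
  pose proof (sqsum_supported m g n Hg) as Lg.
  assert (Hc2 : 0 < c ^ 2) by (apply pow_lt; lra).
  assert (0 <= sqsum w' n).
  { apply Rle_trans with (w' 0%nat ^ 2); [apply pow2_ge_0|apply sqsum_ge_term; lia]. }
  pose proof (Rmult_le_compat_r (sqsum w' n) _ _ H Hsmall).
  apply Rmult_le_reg_l with (c ^ 2); [easy|].
  replace (c ^ 2 * (4 / c ^ 2 * sqsum g m)) with (4 * sqsum g m) by (field; lra).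
  lra.
Qed.

(** Continuity method along [s |-> p(s z)], [0 <= s <= 1]: the polynomial is [1]
    at [s = 0] and [p] at [s = 1], and each [p(s z)] inherits the bound [c] on the
    unit circle. Since [s |-> p(s z)] is Lipschitz on coefficients, finitely many
    equal steps of [decaying_perturb] lead from [0] to [1]. *)
Lemma zero_free_decaying d p c :
  0 < c -> p 0%nat = 1 -> (forall z, Cmod z <= 1 -> c <= Cmod (peval p d z)) ->
  decaying d p.
Proof.
  intros Hc p0 HP.
  set (B := sum_n (fun j => Rabs (p j)) d : R).
  assert (HB : 0 <= B).
  { apply Rle_trans with (Rabs (p 0%nat)); [apply Rabs_pos|].
    apply (sum_n_R_ge_term (fun j => Rabs (p j))); [intros; apply Rabs_pos|lia]. }
  set (L := B * INR d).
  assert (HL : 0 <= L) by (apply Rmult_le_pos; [easy|apply pos_INR]).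
  assert (H2 : 0 < 2 ^ d) by (apply pow_lt; lra).
  (* [L / S N] bounds the change of each coefficient in one step of length
     [1 / S N]; the smallness condition of [decaying_perturb] is the square of
     [2 ^ d * (L / S N) <= c / 2] *)
  destruct (INR_unbounded (2 * 2 ^ d * L / c)) as [N HN].
  assert (HN0 : 0 < INR (S N)) by apply lt_0_INR, Nat.lt_0_succ.
  assert (HN' : 2 * 2 ^ d * L <= c * INR (S N)).
  { rewrite S_INR. apply Rmult_gt_compat_l with (r := c) in HN; [|lra].
    replace (c * (2 * 2 ^ d * L / c)) with (2 * 2 ^ d * L) in HN by (field; lra). lra. }
  assert (Hstep : forall i, (i <= S N)%nat -> decaying d (dilate (INR i / INR (S N)) p)).
  { induction i as [|i IH]; intros Hi.
    - intros m g w Hg Hw. apply is_lim_seq_ext_loc with (fun _ => 0); [|apply is_lim_seq_const].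
      exists (S m). intros k Hk. rewrite <- (Hg k), <- Hw by lia.
      assert (E : forall e, conv e (dilate (INR 0 / INR (S N)) p) w k = w k).
      { assert (Z : INR 0 / INR (S N) = 0) by (simpl (INR 0); unfold Rdiv; ring).
        rewrite Z. induction e as [|e IHe].
        - unfold conv. rewrite sum_O, shift_0. unfold dilate. rewrite p0. simpl. ring.
        - rewrite conv_S, IHe. unfold dilate. rewrite pow_i by lia. ring. }
      apply E.
    - assert (Hfrac : forall j, (j <= S N)%nat -> 0 <= INR j / INR (S N) <= 1).
      { intros j Hj. apply le_INR in Hj. pose proof (pos_INR j). split.
        - apply Rdiv_le_0_compat; lra.
        - apply (Rdiv_le_1 _ _ HN0). lra. }
      assert (Hdiff : Rabs (INR (S i) / INR (S N) - INR i / INR (S N)) = / INR (S N)).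
      { replace (INR (S i) / INR (S N) - INR i / INR (S N)) with (/ INR (S N)).
        - apply Rabs_pos_eq. left. now apply Rinv_0_lt_compat.
        - rewrite (S_INR i). field. lra. }
      apply decaying_perturb with (dilate (INR i / INR (S N)) p) c (L * / INR (S N)).
      + easy.
      + intros z Hz. rewrite peval_dilate. apply HP.
        rewrite Cmod_mult, Hz, Cmod_R, Rmult_1_r.
        specialize (Hfrac i ltac:(lia)). rewrite Rabs_pos_eq; lra.
      + unfold dilate. rewrite p0. simpl. ring.
      + apply Rmult_le_pos; [easy|]. left. now apply Rinv_0_lt_compat.
      + replace (4 ^ d * (L * / INR (S N)) ^ 2) with ((2 ^ d * L / INR (S N)) ^ 2).
        2:{ replace 4 with (2 * 2) by ring. rewrite (Rpow_mult_distr 2 2 d). field. lra. }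
        replace (c ^ 2 / 4) with ((c / 2) ^ 2) by field.
        apply pow_incr. split.
        * apply Rdiv_le_0_compat; [|easy]. apply Rmult_le_pos; lra.
        * apply Rmult_le_reg_r with (INR (S N)); [easy|].
          unfold Rdiv at 1. rewrite Rmult_assoc, Rinv_l by lra. lra.
      + intros j Hj. unfold dilate.
        replace (p j * (INR (S i) / INR (S N)) ^ j - p j * (INR i / INR (S N)) ^ j)
          with (p j * ((INR (S i) / INR (S N)) ^ j - (INR i / INR (S N)) ^ j)) by ring.
        rewrite Rabs_mult. unfold L. rewrite Rmult_assoc.
        apply Rmult_le_compat; try apply Rabs_pos.
        * apply (sum_n_R_ge_term (fun j => Rabs (p j))); [intros; apply Rabs_pos|easy].
        * eapply Rle_trans; [apply Rabs_pow_minus_le; apply Hfrac; lia|].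
          rewrite Hdiff. apply Rmult_le_compat_r; [left; now apply Rinv_0_lt_compat|].
          now apply le_INR.
      + apply IH. lia. }
  specialize (Hstep (S N) (Nat.le_refl _)).
  assert (E1 : INR (S N) / INR (S N) = 1) by (field; lra). rewrite E1 in Hstep.
  intros m g w Hg Hw. apply (Hstep m g w Hg). intros k. rewrite <- Hw.
  apply sum_n_R_ext. intros j. now rewrite dilate_1.
Qed.

Lemma zero_free_sqsum_bound d p c m g w :
  0 < c -> p 0%nat = 1 -> (forall z, Cmod z <= 1 -> c <= Cmod (peval p d z)) ->
  supported m g -> (forall k, conv d p w k = g k) ->
  forall n, c ^ 2 * sqsum w n <= sqsum g m.
Proof.
  intros Hc p0 HP Hg Hw. apply (conv_lower_bound d p); try easy; [lra| |].
  - intros z Hz. apply HP; lra.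
  - exact (zero_free_decaying d p c Hc p0 HP m g w Hg Hw).
Qed.
(** * The power series on the closed disc *)

(** Every point of the plane has a neighbourhood, of size [delta], in which
    [|f| >= delta] at all points of the disc: by continuity if the point lies in the
    disc, vacuously if it lies outside, where the neighbourhood can avoid the
    disc. Compactness of the square of side 2 makes [delta] uniform. *)
Lemma closed_disc_lower_bound (f : C -> C) :
  continuous_on closed_disc f -> (forall z, closed_disc z -> f z <> 0%C) ->
  exists c, 0 < c /\ forall z, closed_disc z -> c <= Cmod (f z).
Proof.
  intros Hf Hnz.
  (* balls of [C] are squares; comparing them with the modulus costs [sqrt 2] *)
  assert (s2 : 0 < sqrt 2 < 2).
  { split; [apply sqrt_lt_R0; lra|].
    rewrite <- (sqrt_square 2) at 2 by lra. apply sqrt_lt_1; lra. }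
  assert (Hloc : forall xy : R * R, exists delta : posreal, forall u v,
    Rabs (u - fst xy) < delta -> Rabs (v - snd xy) < delta ->
    closed_disc (u, v) -> delta <= Cmod (f (u, v))).
  { intros [x y]. cbn [fst snd].
    destruct (Rle_lt_dec (Cmod (x, y)) 1) as [Hin|Hout].
    - pose proof (proj1 (Cmod_gt_0 _) (Hnz _ Hin)) as Hpos.
      set (r := Cmod (f (x, y))) in *.
      assert (Hr : 0 < r / 4) by lra.
      destruct (proj1 (filterlim_locally _ _) (Hf _ Hin) (mkposreal _ Hr)) as [d Hd].
      assert (Hm : 0 < Rmin d (r / 2)) by (apply Rmin_pos; [apply cond_pos|lra]).
      exists (mkposreal _ Hm). cbn [pos]. intros u v Hu Hv Huv.
      assert (B : ball (f (x, y)) (mkposreal _ Hr) (f (u, v))).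
      { apply Hd; [|exact Huv]. split.
        - exact (Rlt_le_trans _ _ _ Hu (Rmin_l _ _)).
        - exact (Rlt_le_trans _ _ _ Hv (Rmin_l _ _)). }
      apply C_NormedModule_mixin_compat2 in B. cbn [pos] in B.
      change (minus (f (u, v)) (f (x, y))) with (f (u, v) - f (x, y))%C in B.
      pose proof (Cmod_triangle (f (u, v)) (- (f (u, v) - f (x, y)))%C) as T.
      rewrite Cmod_opp in T.
      replace (f (u, v) + - (f (u, v) - f (x, y)))%C with (f (x, y)) in T by ring.
      fold r in T. pose proof (Rmin_r d (r / 2)). nra.
    - assert (Hr : 0 < (Cmod (x, y) - 1) / 2) by lra.
      exists (mkposreal _ Hr). cbn [pos]. intros u v Hu Hv Huv.
      unfold closed_disc in Huv.
      pose proof (Cmod_triangle (u, v) (x - u, y - v)) as T.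
      replace (Cplus (u, v) (x - u, y - v)) with ((x, y) : C) in T
        by (unfold Cplus; simpl; f_equal; ring).
      pose proof (Cmod_2Rmax (x - u, y - v)) as M. cbn [fst snd] in M.
      assert (Rmax (Rabs (x - u)) (Rabs (y - v)) < (Cmod (x, y) - 1) / 2).
      { apply Rmax_lub_lt; rewrite Rabs_minus_sym; assumption. }
      pose proof (Rmax_l (Rabs (x - u)) (Rabs (y - v))). pose proof (Rabs_pos (x - u)).
      nra. }
  set (delta := fun x y => proj1_sig (constructive_indefinite_description _ (Hloc (x, y)))).
  destruct (compactness_value_2d (-1) 1 (-1) 1 delta) as [c Hc].
  exists c. split; [apply cond_pos|]. intros [u v] Huv.
  pose proof (Rmax_Cmod (u, v)) as Hmax. cbn [fst snd] in Hmax.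
  unfold closed_disc in Huv.
  assert (-1 <= u <= 1) as Hu.
  { apply Rabs_le_between. pose proof (Rmax_l (Rabs u) (Rabs v)). lra. }
  assert (-1 <= v <= 1) as Hv.
  { apply Rabs_le_between. pose proof (Rmax_r (Rabs u) (Rabs v)). lra. }
  apply Rnot_lt_le; intros Hlt. apply (Hc u v Hu Hv).
  intros (x & y & _ & _ & Hx & Hy & Hle). unfold delta in *.
  destruct (constructive_indefinite_description _ (Hloc (x, y))) as [e He]; cbn [proj1_sig] in *.
  specialize (He u v Hx Hy Huv). lra.
Qed.

Lemma power_series_coef_bounded a s :
  power_series_sum a 1 s -> exists B, 0 <= B /\ forall k, Rabs (a (S k)) <= B.
Proof.
  intros H. unfold power_series_sum, is_series in H.
  destruct (proj1 (filterlim_locally_ball_norm _ _) H (mkposreal 1 Rlt_0_1)) as [N HN].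
  set (u := fun k => (RtoC (a (S k)) * 1 ^ S k)%C) in *.
  assert (HN' : forall n, (N <= n)%nat -> Cmod (sum_n u n - s)%C < 1).
  { intros n Hn. exact (HN n Hn). }
  assert (HB : 0 <= sum_n (fun k => Rabs (a (S k))) N).
  { eapply Rle_trans; [apply Rabs_pos|apply Rabs_sum_n]. }
  exists (sum_n (fun k => Rabs (a (S k))) N + 2). split; [lra|]. intros k.
  destruct (Nat.le_gt_cases k N) as [Hk|Hk].
  - pose proof (sum_n_R_ge_term (fun k => Rabs (a (S k))) N k
      (fun j => Rabs_pos _) Hk) as L. cbv beta in L. lra.
  - destruct k as [|k]; [lia|].
    pose proof (HN' k ltac:(lia)). pose proof (HN' (S k) ltac:(lia)) as H1.
    pose proof (Cmod_triangle (sum_n u (S k) - s)%C (- (sum_n u k - s))%C) as T.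
    rewrite Cmod_opp, sum_n_C_S in T. rewrite sum_n_C_S in H1.
    replace (sum_n u k + u (S k) - s + - (sum_n u k - s))%C with (u (S k)) in T by ring.
    unfold u at 1 in T. rewrite Cpow_1_l, Cmult_1_r, Cmod_R in T. lra.
Qed.

(** Convergence at [z = 1] bounds the coefficients, and on the disc of radius
    [rho] the tails are then dominated by those of a geometric series. *)
Lemma power_series_partial_sums_uniform a A rho eps :
  (forall z, closed_disc z -> power_series_sum a z (A z)) ->
  0 <= rho < 1 -> 0 < eps ->
  exists N0, forall N z, (N0 <= N)%nat -> Cmod z <= 1 ->
    Cmod (A (RtoC rho * z)%C - sum_n (fun k => (RtoC (a (S k)) * (RtoC rho * z) ^ S k)%C) N)%C
      <= eps.
Proof.
  intros HA Hrho Heps.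
  destruct (power_series_coef_bounded a (A 1)) as (B & HB & Ha).
  { apply HA. unfold closed_disc. rewrite Cmod_1. lra. }
  assert (Hy : 0 < eps * (1 - rho) / (B + 1)).
  { apply Rdiv_lt_0_compat; [apply Rmult_lt_0_compat|]; lra. }
  destruct (pow_lt_1_zero rho ltac:(rewrite Rabs_pos_eq; lra) _ Hy) as [N0 HN0].
  exists N0. intros N z HN Hz.
  specialize (HN0 (S (S N)) ltac:(lia)). rewrite Rabs_pos_eq in HN0 by (apply pow_le; lra).
  set (u := fun k => (RtoC (a (S k)) * (RtoC rho * z) ^ S k)%C).
  assert (Hu : forall k, Cmod (u k) <= B * rho ^ S k).
  { intros k. unfold u. rewrite Cmod_mult, Cmod_R, Cmod_pow, Cmod_mult, Cmod_R.
    rewrite (Rabs_pos_eq rho) by lra.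
    pose proof (Cmod_ge_0 z).
    apply Rmult_le_compat; [apply Rabs_pos|apply pow_le; nra|auto|].
    apply pow_incr. nra. }
  assert (Htail : forall e, Cmod (sum_n u (N + e) - sum_n u N)%C
                    <= B * rho ^ S (S N) * ((1 - rho ^ e) / (1 - rho))).
  { induction e as [|e IH].
    - rewrite Nat.add_0_r. replace (sum_n u N - sum_n u N)%C with (RtoC 0) by ring.
      rewrite Cmod_0. simpl. right. field. lra.
    - rewrite Nat.add_succ_r, sum_n_C_S.
      replace (sum_n u (N + e) + u (S (N + e)) - sum_n u N)%C
        with (sum_n u (N + e) - sum_n u N + u (S (N + e)))%C by ring.
      eapply Rle_trans; [apply Cmod_triangle|].
      eapply Rle_trans; [apply Rplus_le_compat; [exact IH|apply Hu]|].
      right. change (S (S (N + e))) with (S (S N) + e)%nat. rewrite pow_add.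
      simpl. field. lra. }
  assert (Hbound : B * rho ^ S (S N) * (1 / (1 - rho)) <= eps).
  { assert (rho ^ S (S N) * (B + 1) <= eps * (1 - rho)).
    { apply Rmult_lt_compat_r with (r := B + 1) in HN0; [|lra].
      replace (eps * (1 - rho) / (B + 1) * (B + 1)) with (eps * (1 - rho)) in HN0
        by (field; lra). lra. }
    assert (0 <= rho ^ S (S N)) by (apply pow_le; lra).
    apply Rmult_le_reg_r with (1 - rho); [lra|].
    replace (B * rho ^ S (S N) * (1 / (1 - rho)) * (1 - rho)) with (B * rho ^ S (S N))
      by (field; lra). lra. }
  apply le_epsilon; intros e He.
  assert (Hd : closed_disc (RtoC rho * z)%C).
  { unfold closed_disc. rewrite Cmod_mult, Cmod_R, Rabs_pos_eq by lra.
    pose proof (Cmod_ge_0 z). nra. }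
  destruct (proj1 (filterlim_locally_ball_norm _ _) (HA _ Hd) (mkposreal e He)) as [M HM].
  specialize (HM (N + M)%nat ltac:(lia)). fold u in HM.
  assert (HM' : Cmod (sum_n u (N + M) - A (RtoC rho * z))%C < e).
  { exact HM. }
  replace (A (RtoC rho * z) - sum_n u N)%C
    with (- (sum_n u (N + M) - A (RtoC rho * z)) + (sum_n u (N + M) - sum_n u N))%C by ring.
  eapply Rle_trans; [apply Cmod_triangle|]. rewrite Cmod_opp.
  specialize (Htail M).
  assert (B * rho ^ S (S N) * ((1 - rho ^ M) / (1 - rho)) <= B * rho ^ S (S N) * (1 / (1 - rho))).
  { apply Rmult_le_compat_l.
    - apply Rmult_le_pos; [easy|apply pow_le; lra].
    - apply Rmult_le_compat_r; [left; apply Rinv_0_lt_compat; lra|].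
      assert (0 <= rho ^ M) by (apply pow_le; lra). lra. }
  lra.
Qed.

(** * The Volterra equation *)

(** The truncations of [1 - a(rho z)]. *)
Definition volterra_poly (a : nat -> R) (rho : R) (j : nat) : R :=
  match j with O => 1 | S _ => - (a j * rho ^ j) end.

Lemma peval_volterra_poly a rho N z :
  peval (volterra_poly a rho) (S N) z =
  (1 - sum_n (fun k => (RtoC (a (S k)) * (RtoC rho * z) ^ S k)%C) N)%C.
Proof.
  unfold peval. rewrite sum_n_C_head. unfold volterra_poly at 1.
  change (z ^ 0)%C with (RtoC 1). rewrite Cmult_1_l.
  rewrite (sum_n_C_ext _ (fun k => (RtoC (-1) * (RtoC (a (S k)) * (RtoC rho * z) ^ S k))%C)).
  - rewrite sum_n_C_scal. replace (RtoC (-1)) with (- (1))%C by (rewrite <- RtoC_opp; f_equal; lra).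
    ring.
  - intros k. unfold volterra_poly.
    replace (- (a (S k) * rho ^ S k)) with (-1 * (a (S k) * rho ^ S k)) by ring.
    rewrite !RtoC_mult, Cpow_mult_l, <- RtoC_pow. ring.
Qed.

(** The degree [S N] of the truncation is at least [k], so all coefficients that
    enter the equation for [x k] are present. *)
Lemma solution_conv a x rho N k :
  is_solution a x -> (k <= S N)%nat ->
  conv (S N) (volterra_poly a rho) (dilate rho x) k = trunc 0 (fun _ => x 0%nat) k.
Proof.
  intros Hx Hk. destruct k as [|i].
  - rewrite conv_leading by lia. unfold dilate, trunc; simpl. ring.
  - unfold conv. rewrite sum_n_R_head, shift_0.
    change (trunc 0 (fun _ => x 0%nat) (S i)) with 0.
    rewrite (sum_n_R_zero_tail _ i).
    2:{ intros j Hj. unfold shift. rewrite (proj2 (Nat.leb_gt (S j) (S i))) by lia. ring. }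
    2:{ lia. }
    unfold dilate at 1. rewrite (Hx (S i)) by lia.
    replace (S i - 1)%nat with i by lia.
    rewrite <- sum_n_R_rev.
    assert (E : sum_n (fun j => volterra_poly a rho (S j) * shift (S j) (dilate rho x) (S i)) i
      = sum_n (fun j => - rho ^ S i * (a (S i - (i - j))%nat * x (i - j)%nat)) i :> R).
    2:{ rewrite E, sum_n_R_scal. unfold volterra_poly. ring. }
    apply sum_n_ext_loc.
    intros j Hj. unfold shift, volterra_poly, dilate.
    rewrite (proj2 (Nat.leb_le (S j) (S i))) by lia.
    replace (S i - (i - j))%nat with (S j) by lia.
    replace (S i - S j)%nat with (i - j)%nat by lia.
    replace (S i) with (S j + (i - j))%nat at 1 by lia. rewrite pow_add. apply Rminus_diag_uniq. ring.
Qed.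

(** Each weight [rho ^ (2 k)], [k <= m], is at least
    [rho ^ (2 m) >= 1 - 2 m (1 - rho)], so it is enough to take [1 - rho] small
    compared with [1 / (2 m |x|^2)]. *)
Lemma sqsum_Abel_limit x K m :
  (forall rho, 0 <= rho < 1 -> sqsum (dilate rho x) m <= K) -> sqsum x m <= K.
Proof.
  intros H.
  assert (Hx : 0 <= sqsum x m).
  { apply Rle_trans with (x 0%nat ^ 2); [apply pow2_ge_0|apply sqsum_ge_term; lia]. }
  assert (Hm : 0 <= INR (2 * m)) by apply pos_INR.
  apply le_epsilon; intros eps Heps.
  set (D := INR (2 * m) * sqsum x m + 1).
  assert (HD : 1 <= D) by (unfold D; nra).
  set (t := Rmin 1 (eps / D)).
  assert (Ht : 0 < t <= 1).
  { split; [apply Rmin_pos; [lra|apply Rdiv_lt_0_compat; lra]|apply Rmin_l]. }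
  assert (HtD : t * D <= eps).
  { apply Rle_trans with (eps / D * D); [|right; field; lra].
    apply Rmult_le_compat_r; [lra|apply Rmin_r]. }
  specialize (H (1 - t) ltac:(lra)).
  assert (L : (1 - t) ^ (2 * m) * sqsum x m <= sqsum (dilate (1 - t) x) m).
  { unfold sqsum. rewrite <- sum_n_R_scal. apply sum_n_R_le. intros k Hk.
    unfold dilate. rewrite Rpow_mult_distr, <- pow_mult, Rmult_comm.
    apply Rmult_le_compat_l; [apply pow2_ge_0|].
    replace (2 * m)%nat with (k * 2 + (2 * m - k * 2))%nat by lia.
    rewrite pow_add. rewrite <- (Rmult_1_r ((1 - t) ^ (k * 2))) at 2.
    apply Rmult_le_compat_l; [apply pow_le; lra|].
    rewrite <- (pow1 (2 * m - k * 2)) at 2. apply pow_incr. lra. }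
  pose proof (Rabs_pow_minus_le 1 (1 - t) (2 * m) ltac:(lra) ltac:(lra)) as P.
  rewrite pow1 in P. replace (1 - (1 - t)) with t in P by ring.
  rewrite (Rabs_pos_eq t) in P by lra.
  pose proof (Rle_abs (1 - (1 - t) ^ (2 * m))) as P'.
  assert (Q : (1 - (1 - t) ^ (2 * m)) * sqsum x m <= INR (2 * m) * t * sqsum x m).
  { apply Rmult_le_compat_r; lra. }
  unfold D in HtD. nra.
Qed.

(** The factor [2] comes from truncating [1 - a(rho z)], which may cost half of
    the lower bound [c]. *)
Lemma solution_sqsum_bound a A c x :
  (forall z, closed_disc z -> power_series_sum a z (A z)) ->
  0 < c -> (forall z, closed_disc z -> c <= Cmod (1 - A z)%C) ->
  is_solution a x -> forall m, sqsum x m <= (2 * x 0%nat / c) ^ 2.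
Proof.
  intros HA Hc HcA Hx m. apply sqsum_Abel_limit. intros rho Hrho.
  destruct (power_series_partial_sums_uniform a A rho (c / 2) HA Hrho ltac:(lra)) as [N0 HN0].
  set (N := (N0 + m)%nat). set (p := volterra_poly a rho).
  assert (HP : forall z, Cmod z <= 1 -> c / 2 <= Cmod (peval p (S N) z)).
  { intros z Hz. unfold p. rewrite peval_volterra_poly.
    specialize (HN0 N z ltac:(unfold N; lia) Hz).
    set (s := sum_n _ N) in *.
    assert (Hd : closed_disc (RtoC rho * z)%C).
    { unfold closed_disc. rewrite Cmod_mult, Cmod_R, Rabs_pos_eq by lra.
      pose proof (Cmod_ge_0 z). nra. }
    pose proof (HcA _ Hd).
    pose proof (Cmod_triangle (1 - s)%C (- (A (RtoC rho * z) - s))%C) as T.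
    rewrite Cmod_opp in T.
    replace (1 - s + - (A (RtoC rho * z) - s))%C with (1 - A (RtoC rho * z))%C in T by ring.
    lra. }
  set (g := trunc 0 (fun _ => x 0%nat)).
  destruct (conv_solution_exists (S N) p g eq_refl) as [w Hw].
  pose proof (zero_free_sqsum_bound (S N) p (c / 2) 0 g w ltac:(lra) eq_refl HP
    (trunc_supported 0 _) Hw m) as L.
  rewrite (sqsum_ext w (dilate rho x)) in L.
  - assert (E : sqsum g 0 = x 0%nat ^ 2) by (unfold sqsum; now rewrite sum_O).
    rewrite E in L. apply Rmult_le_reg_l with ((c / 2) ^ 2); [apply pow_lt; lra|].
    replace ((c / 2) ^ 2 * (2 * x 0%nat / c) ^ 2) with (x 0%nat ^ 2) by (field; lra).
    exact L.
  - intros k Hk. apply (conv_unique (S N) p _ _ (S N)); [reflexivity| |unfold N; lia].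
    intros j Hj. rewrite Hw. symmetry. now apply solution_conv.
Qed.

Theorem theorem8 (a : nat -> R) (A : C -> C)
  (a_converges : forall z : C, closed_disc z -> power_series_sum a z (A z))
  (a_continuous : continuous_on closed_disc (fun z : C => (1 - A z)%C))
  (a_no_zero : forall z : C, closed_disc z -> (1 - A z)%C <> 0%C) :
  null_asymptotically_stable a.
Proof.
  destruct (closed_disc_lower_bound _ a_continuous a_no_zero) as (c & Hc & HcA).
  pose proof (fun x => solution_sqsum_bound a A c x a_converges Hc HcA) as Hx.
  split.
  - intros eps Heps. exists (c / 2 * eps). split; [apply Rmult_lt_0_compat; lra|].
    intros x Hs H0 n.
    pose proof (Rle_trans _ _ _ (sqsum_ge_term x n n (Nat.le_refl n)) (Hx x Hs n)) as L.
    apply Rle_lt_trans with (Rabs (2 * x 0%nat / c)).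
    + apply Rsqr_le_abs_0. unfold Rsqr. simpl in L. lra.
    + replace (2 * x 0%nat / c) with (2 / c * x 0%nat) by (field; lra).
      assert (H2c : 0 < 2 / c) by (apply Rdiv_lt_0_compat; lra).
      rewrite Rabs_mult, (Rabs_pos_eq (2 / c)) by lra.
      apply Rlt_le_trans with (2 / c * (c / 2 * eps)); [now apply Rmult_lt_compat_l|].
      right. field. lra.
  - exists 1. split; [lra|]. intros x Hs _.
    exact (bounded_sqsum_lim_0 x _ (Hx x Hs)).
Qed.
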